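(* Let $x_0\sim p_{\mathrm{data}}$ be an integrable random vector in $\mathbb R^d$, let $\varepsilon\sim\mathcal N(0,I_d)$ be independent of $x_0$, and let $x_t=\alpha_t x_0+\sigma_t\varepsilon$ with $\alpha_t\ne 0$, $t\in[0,1]$. Let $\epsilon^\star$ be the minimizer of the diffusion loss $$\mathcal L(\epsilon)=\mathbb E_{t,x_0,\varepsilon}\bigl\|\varepsilon-\epsilon(\alpha_t x_0+\sigma_t\varepsilon,t)\bigr\|^2$$ over measurable functions $\epsilon(\cdot,\cdot)$. Let $\hat x^\star$ be the welfare-maximizing decision rule, i.e. the solution of the planner's problem $$\max_{\hat x}\; -\mathbb E\bigl[\|x_0-\hat x(x_t)\|^2\bigr]\iff\min_{\hat x}\;\mathbb E\|x_0-\hat x(x_t)\|^2$$ over measurable $\hat x:\mathbb R^d\to\mathbb R^d$. Then $\epsilon^\star$ implements $\hat x^\star$ through the linear relationship $$\hat x^\star(x_t)=\frac1{\alpha_t}\bigl(x_t-\sigma_t\,\epsilon^\star(x_t,t)\bigr).$$ Thus solving the diffusion training problem (minimizing $\mathcal L$) is equivalent, through this relationship, to solving the planner's problem.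
   Context: The law $p_{\mathrm{data}}$ is otherwise arbitrary (unknown). The deterministic scalars $\alpha_t,\sigma_t$, $t\in[0,1]$, form a variance-preserving diffusion noise schedule with $\alpha_0=1$, $\sigma_0=0$, $\alpha_1\approx0$, $\sigma_1\approx1$. In $\mathcal L$, the time $t$ is random in $[0,1]$ and independent of $(x_0,\varepsilon)$. The minimizer of $\mathcal L$ is taken to be $\epsilon^\star(x_t,t)=\mathbb E[\varepsilon\mid x_t]$. Decision rules are identified up to almost sure equality.
   Formalization: In the closing equivalence, at times with σ_t=0 (where the relationship does not involve ε) the planner's side also requires ε(x_t,t)=E[ε|x_t]; without this the converse fails when the law of t charges such times. *)

(* Defs.v *)
(* MathComp-Analysis.  Vectors of R^d are d.-tuple R with the library's product
   sigma-algebra; R^d-valued operations are written coordinatewise. *)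
From HB Require Import structures.
From mathcomp Require Import all_boot all_order all_algebra.
From mathcomp Require Import all_classical all_reals all_analysis.

Set Implicit Arguments.
Unset Strict Implicit.
Unset Printing Implicit Defensive.

Import Order.TTheory GRing.Theory Num.Theory.
Import numFieldNormedType.Exports.

Local Open Scope classical_set_scope.
Local Open Scope ring_scope.

(* Squared Euclidean distance (the library norm on R^d is the sup norm). *)
Definition sqdist (R : realType) (d : nat) (u v : d.-tuple R) : R :=
  \sum_(i < d) (tnth u i - tnth v i) ^+ 2.

(* a x + s e *)
Definition forward (R : realType) (d : nat) (a s : R) (x e : d.-tuple R) :
    d.-tuple R :=
  [tuple a * tnth x i + s * tnth e i | i < d].

(* a^-1 (x - s e) *)
Definition denoise (R : realType) (d : nat) (a s : R) (x e : d.-tuple R) :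
    d.-tuple R :=
  [tuple a^-1 * (tnth x i - s * tnth e i) | i < d].

(* Only the exact normalizations are kept: alpha_1 ~ 0 and sigma_1 ~ 1 have no
   exact content, and no sign or monotonicity is imposed.  Measurability in t
   is what makes x_tau a random vector when the time tau is random. *)
Record vp_schedule (R : realType) (alpha sigma : R -> R) : Prop := VPSchedule {
  vp_measurable_alpha : measurable_fun (`[0, 1]%classic : set R) alpha ;
  vp_measurable_sigma : measurable_fun (`[0, 1]%classic : set R) sigma ;
  vp_variance : forall t, t \in `[0, 1] -> alpha t ^+ 2 + sigma t ^+ 2 = 1 ;
  vp_alpha0 : alpha 0 = 1 ;
  vp_sigma0 : sigma 0 = 0 }.

Definition argmin (R : realType) (T : Type) (D : set T) (J : T -> \bar R) :
    set T :=
  [set f | D f /\ forall g, D g -> (J f <= J g)%E].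

Definition argmax (R : realType) (T : Type) (D : set T) (J : T -> \bar R) :
    set T :=
  [set f | D f /\ forall g, D g -> (J g <= J f)%E].

Section random_vectors.
Context (R : realType) (dO : measure_display) (Omega : measurableType dO).
Variable P : probability Omega R.

Definition independent_RVs (d1 d2 : measure_display) (T1 : measurableType d1)
    (T2 : measurableType d2) (X : Omega -> T1) (Y : Omega -> T2) : Prop :=
  forall A B, measurable A -> measurable B ->
    P (X @^-1` A `&` Y @^-1` B) = (P (X @^-1` A) * P (Y @^-1` B))%E.

Context (d : nat).
Implicit Types (X Y : Omega -> d.-tuple R) (g : d.-tuple R -> d.-tuple R).

(* Y ~ N(0, I_d): the law of Y is the d-fold product of N(0, 1); measurable
   boxes determine it. *)
Definition std_gaussian Y : Prop :=
  forall A : 'I_d -> set R, (forall i, measurable (A i)) ->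
    P [set w | forall i, A i (tnth (Y w) i)] =
    (\prod_(i < d) normal_prob 0 1 (A i))%E.

Definition integrable_vector Y : Prop :=
  forall i, P.-integrable [set: Omega] (fun w => (tnth (Y w) i)%:E).

(* g(X) is a version of the conditional expectation E[Y | X]. *)
Definition is_cond_expectation Y X g : Prop :=
  [/\ measurable_fun [set: d.-tuple R] g,
      integrable_vector (g \o X) &
      forall (i : 'I_d) (B : set (d.-tuple R)), measurable B ->
        (\int[P]_(w in X @^-1` B) (tnth (g (X w)) i)%:E =
         \int[P]_(w in X @^-1` B) (tnth (Y w) i)%:E)%E].

Definition decision_rules : set (d.-tuple R -> d.-tuple R) :=
  [set xh | measurable_fun [set: d.-tuple R] xh].

Definition mse (x0 xt : Omega -> d.-tuple R) (xh : d.-tuple R -> d.-tuple R) :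
    \bar R :=
  ('E_P[fun w => sqdist (x0 w) (xh (xt w))])%E.

Definition welfare (x0 xt : Omega -> d.-tuple R)
    (xh : d.-tuple R -> d.-tuple R) : \bar R :=
  (- mse x0 xt xh)%E.

Definition planner_solutions (x0 xt : Omega -> d.-tuple R) :
    set (d.-tuple R -> d.-tuple R) :=
  argmax decision_rules (welfare x0 xt).

(* The noise predictor f implements the planner's rule from the observation xt:
   up to almost sure equality, the solutions of the planner's problem are
   exactly the rule a^-1 (x - s f(x)). *)
Definition implements_planner (a s : R) (x0 xt : Omega -> d.-tuple R)
    (f : d.-tuple R -> d.-tuple R) : Prop :=
  forall xh, decision_rules xh ->
    (planner_solutions x0 xt xh <->
     {ae P, forall w, xh (xt w) = denoise a s (xt w) (f (xt w))}).

(* Measurable functions of (x, t) in R^d * [0, 1]; values at times outside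
   [0, 1] are junk and never used. *)
Definition noise_predictors : set (d.-tuple R -> R -> d.-tuple R) :=
  [set e | measurable_fun ([set: d.-tuple R] `*` (`[0, 1]%classic : set R))
             (fun z => e z.1 z.2)].

Definition diffusion_loss (alpha sigma : R -> R)
    (x0 eps : Omega -> d.-tuple R) (tau : Omega -> R)
    (e : d.-tuple R -> R -> d.-tuple R) : \bar R :=
  ('E_P[fun w => sqdist (eps w)
     (e (forward (alpha (tau w)) (sigma (tau w)) (x0 w) (eps w)) (tau w))])%E.

Definition loss_minimizers (alpha sigma : R -> R)
    (x0 eps : Omega -> d.-tuple R) (tau : Omega -> R) :
    set (d.-tuple R -> R -> d.-tuple R) :=
  argmin noise_predictors (diffusion_loss alpha sigma x0 eps tau).

End random_vectors.

(* Main.v *)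
(* The loss at time t splits orthogonally, E|eps - e(x_t)|^2 =
   E|eps - m(x_t)|^2 + E|m(x_t) - e(x_t)|^2 with m(x_t) = E[eps | x_t], so that
   being optimal amounts to the residual eps - e(x_t) integrating to zero over
   every event of x_t.  Since x_0 - a^-1 (x_t - s f(x_t)) = - (s / a) (eps - f(x_t)),
   the map f |-> a^-1 (x_t - s f) carries the denoising problem at time t to the
   planner's problem when s != 0; when s = 0, x_t determines x_0 and the planner's
   error is 0.

   As the time is random, a minimizer of the loss has a residual orthogonal to the
   events of (x_tau, tau).  Fubini turns this into orthogonality to the events of
   x_t at almost every t, for one event of x_t at a time; a countable pi-system
   generating the events of R^d makes the exceptional null set uniform, and no
   jointly measurable version of E[eps | x_t] needs to be constructed. *)
Require Import Defs.
From HB Require Import structures.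
From mathcomp Require Import all_boot all_order all_algebra.
From mathcomp Require Import all_classical all_reals all_analysis measurable_realfun.
From mathcomp Require Import finmap ring lra.

Set Implicit Arguments.
Unset Strict Implicit.
Unset Printing Implicit Defensive.

Import Order.TTheory GRing.Theory Num.Theory.
Import numFieldNormedType.Exports.

Local Open Scope classical_set_scope.
Local Open Scope ring_scope.

(** * Variables orthogonal to the events of an observation *)

Section centered.
Context (R : realType) (dO dT : measure_display) (Omega : measurableType dO)
  (T : measurableType dT) (P : probability Omega R).
Variable X : Omega -> T.
Hypothesis mX : measurable_fun [set: Omega] X.

(** This is E[U | X] = 0, stated through integrals over the events of X so that no conditional
    expectation has to be constructed. *)
Definition centered (U : Omega -> R) : Prop :=
  P.-integrable [set: Omega] (EFin \o U) /\
  forall B, measurable B -> (\int[P]_(w in X @^-1` B) (U w)%:E = 0)%E.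

Lemma measurable_preimage (B : set T) : measurable B -> measurable (X @^-1` B).
Proof. by move=> mB; rewrite -[X @^-1` B]setTI; exact: mX. Qed.

Import HBNNSimple.

(** A simple function is a finite sum of y times the indicator of {f = y}, and each term contributes
    y times the integral of U over an event of X. *)
Lemma centered_nnsfun (U : Omega -> R) (f : {nnsfun T >-> R}) :
  centered U -> (\int[P]_w (f (X w) * U w)%:E = 0)%E.
Proof.
move=> [iU cU].
have iUB B : measurable B ->
    P.-integrable [set: Omega] (fun w => (U w * \1_B (X w))%:E).
  move=> mB; have mXB := measurable_preimage mB.
  have := (integrable_mkcond (EFin \o U) mXB).1
    (integrableS measurableT mXB (subsetT _) iU).
  apply: eq_integrable => // w _.
  by rewrite epatch_indic /= EFinM !indicE.
have e w : (f (X w) * U w)%:E =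
    (\sum_(y <- fset_set (range f))
      (y%:E * (U w * \1_(f @^-1` [set y]) (X w))%:E))%E.
  rewrite [in LHS]fimfunE fsbig_finite//= big_distrl/= -sumEFin.
  by apply: eq_bigr => y _; rewrite -EFinM mulrAC -mulrA.
under eq_integral do rewrite e.
have mf y : measurable (f @^-1` [set y]) by [].
rewrite integral_sum//; last first.
  by move=> y; apply: integrableZl => //; exact: iUB.
apply: big1 => y _.
rewrite integralZl//; last exact: iUB.
rewrite (_ : (\int[P]_w _)%E = 0%E) ?mule0//.
rewrite -[RHS](cU _ (mf y)) [RHS]integral_mkcond.
apply: eq_integral => w _.
by rewrite epatch_indic /= EFinM !indicE.
Qed.

(** Simple functions increase to k, and M |U| dominates their products with U, so dominated
    convergence passes the vanishing integrals to the limit. *)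
Lemma centered_nneg_bounded (U : Omega -> R) (k : T -> R) (M : R) :
  centered U -> measurable_fun [set: T] k -> (forall t, 0 <= k t <= M) ->
  (\int[P]_w (k (X w) * U w)%:E = 0)%E.
Proof.
move=> cU mk kM; have [iU _] := cU.
have mek : measurable_fun [set: T] (EFin \o k) by exact/measurable_EFinP.
pose f := nnsfun_approx measurableT mek.
have k0 t : [set: T] t -> (0 <= (EFin \o k) t)%E.
  by move=> _; rewrite lee_fin; have /andP[] := kM t.
have fk t : EFin \o f ^~ t @ \oo --> (k t)%:E by exact: cvg_nnsfun_approx.
have fk' t : f ^~ t @ \oo --> k t.
  by have /fine_cvgP[] := fk t.
have fle n t : f n t <= k t.
  have nd : nondecreasing_seq (f ^~ t).
    by move=> a b ab; exact/lefP/nd_nnsfun_approx.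
  rewrite -(cvg_lim _ (fk' t))//; apply: nondecreasing_cvgn_le => //.
  exact/cvgP/fk'.
have mU : measurable_fun [set: Omega] U.
  exact/measurable_EFinP/measurable_int/iU.
have : (\int[P]_w (f n (X w) * U w)%:E)%E @[n --> \oo] -->
    (\int[P]_w (k (X w) * U w)%:E)%E.
  have [] // := @dominated_convergence _ _ _ P setT measurableT
    (fun n w => (f n (X w) * U w)%:E) (fun w => (k (X w) * U w)%:E)
    (fun w => (M%:E * `|(U w)%:E|)%E).
  - move=> n; apply/measurable_EFinP/measurable_funM => //.
    exact: measurableT_comp.
  - apply/measurable_EFinP/measurable_funM => //.
    exact: measurableT_comp.
  - apply: aeW => w _; apply: cvg_EFin; first by apply: nearW.
    by apply: cvgMl; exact: fk'.
  - by apply: integrableZl => //; exact: integrable_abse iU.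
  - apply: aeW => w n _ /=; rewrite lee_fin normrM.
    apply: ler_wpM2r => //; rewrite ger0_norm ?fun_ge0//.
    by rewrite (le_trans (fle _ _))//; have /andP[] := kM (X w).
under eq_fun do rewrite centered_nnsfun//.
by move=> /cvg_lim <- //; rewrite lim_cst.
Qed.

(** The shift k + M is nonnegative and bounded by 2 M. The added term M U integrates to zero because
    the whole space is an event of X. *)
Lemma centered_bounded (U : Omega -> R) (k : T -> R) (M : R) :
  centered U -> measurable_fun [set: T] k -> (forall t, `|k t| <= M) ->
  P.-integrable [set: Omega] (fun w => (k (X w) * U w)%:E) /\
  (\int[P]_w (k (X w) * U w)%:E = 0)%E.
Proof.
move=> cU mk kM; have [iU c0] := cU.
have ikU : P.-integrable [set: Omega] (fun w => (k (X w) * U w)%:E).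
  apply: (@integrableMr _ _ _ P _ measurableT (k \o X) (EFin \o U)) => //.
    exact: measurableT_comp.
  exists M; split; first exact: num_real.
  by move=> m Mm w _ /=; rewrite (le_trans (kM _))// ltW.
split => //.
have e : (\int[P]_w ((k (X w) + M) * U w)%:E = 0)%E.
  apply: (@centered_nneg_bounded U (fun t => k t + M) (M + M)) => //.
    exact: measurable_funD.
  by move=> t; have := kM t; rewrite ler_norml => /andP[]; lra.
have U0 : (\int[P]_w (U w)%:E = 0)%E.
  by have := c0 _ measurableT; rewrite preimage_setT.
rewrite -e; under [RHS]eq_integral do rewrite mulrDl EFinD (EFinM M).
rewrite integralD//; last by apply: integrableZl.
by rewrite integralZl// [X in (_ * X)%E]U0 mule0 adde0.
Qed.

End centered.

(** * Least squares and centered residuals *)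

Section optimality.
Context (R : realType) (dO dT : measure_display) (Omega : measurableType dO)
  (T : measurableType dT) (P : probability Omega R).
Variable X : Omega -> T.
Hypothesis mX : measurable_fun [set: Omega] X.

(* (y - h)^2 - (y - g)^2 = (g - h)^2 + 2 (g - h) (y - g), and the cross term
   integrates to zero once truncated to the event where g and h are bounded; no
   square integrability of y is needed. *)
Lemma centered_optimal (y : Omega -> R) (g h : T -> R) :
  measurable_fun [set: Omega] y ->
  measurable_fun [set: T] g -> measurable_fun [set: T] h ->
  centered P X (fun w => y w - g (X w)) ->
  (\int[P]_w ((y w - g (X w)) ^+ 2)%:E <= \int[P]_w ((y w - h (X w)) ^+ 2)%:E)%E.
Proof.
move=> my mg mh cU.
have mgX : measurable_fun [set: Omega] (fun w => g (X w)).
  exact: measurableT_comp.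
have mhX : measurable_fun [set: Omega] (fun w => h (X w)).
  exact: measurableT_comp.
have mU2 : measurable_fun [set: Omega] (fun w => ((y w - g (X w)) ^+ 2)%:E).
  by apply/measurable_EFinP/measurable_funX/measurable_funB.
have mV2 : measurable_fun [set: Omega] (fun w => ((y w - h (X w)) ^+ 2)%:E).
  by apply/measurable_EFinP/measurable_funX/measurable_funB.
have [->|fin] := eqVneq (\int[P]_w ((y w - h (X w)) ^+ 2)%:E)%E +oo%E.
  exact: leey.
have iV : P.-integrable [set: Omega] (fun w => ((y w - h (X w)) ^+ 2)%:E).
  apply/integrableP; split => //.
  under eq_integral do rewrite /= ger0_norm ?sqr_ge0//.
  by rewrite ltey.
pose B n := [set t | `|g t| <= n%:R] `&` [set t | `|h t| <= n%:R].
have mB n : measurable (B n).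
  by apply: measurableI; rewrite -[X in measurable X]setTI;
    apply: (measurable_fun_ler (g := cst n%:R)) => //; exact: measurableT_comp.
(* With U = y - g(X), one has (y - h)^2 - k U = (y - g)^2 + (g - h)^2 on [B n], and k vanishes
   elsewhere. Being bounded, k(X) U integrates to zero, so subtracting it leaves the integral of (y
   - h)^2 unchanged. *)
pose k n t := 2 * (g t - h t) * \1_(B n) t.
have mk n : measurable_fun [set: T] (k n).
  by apply: measurable_funM => //; apply: measurable_funM => //; apply: measurable_funB.
have kb n t : `|k n t| <= 4 * n%:R.
  rewrite /k indicE; case: (boolP (t \in B n)) => [/set_mem[/= gb hb]|_] /=.
    by rewrite mulr1 normrM ger0_norm//; have := ler_normB (g t) (h t); lra.
  by rewrite mulr0 normr0 mulr_ge0.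
pose F n := X @^-1` B n.
have mF n : measurable (F n) by exact: measurable_preimage.
have step n : (\int[P]_(w in F n) ((y w - g (X w)) ^+ 2)%:E <=
    \int[P]_w ((y w - h (X w)) ^+ 2)%:E)%E.
  have [ik k0] := centered_bounded mX cU (mk n) (kb n).
  rewrite -[leRHS]sube0 -k0 -integralB// [leLHS]integral_mkcond.
  apply: ge0_le_integral => //.
  - by move=> w _; apply: erestrict_ge0 => x _; rewrite lee_fin sqr_ge0.
  - exact/(measurable_restrictT _ _).1/measurable_funTS.
  - exact: measurable_int (integrableB measurableT iV ik).
  - move=> w _; rewrite epatch_indic /= !indicE -EFinM -EFinB lee_fin /k indicE.
    have -> : (w \in F n) = (X w \in B n) by apply/idP/idP => /set_mem ?; exact/mem_set.
    case: (X w \in B n) => /=; rewrite ?mulr1 ?mulr0 ?mul0r ?subr0 ?sqr_ge0//.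
    rewrite -subr_ge0 (_ : _ - _ = (g (X w) - h (X w)) ^+ 2) ?sqr_ge0//; ring.
(* The events [F n] increase to the whole space, so monotone convergence removes the truncation. *)
have FT : \bigcup_n F n = setT.
  rewrite -subTset => w _.
  pose m := (Num.trunc (`|g (X w)| + `|h (X w)|)).+1.
  have mM : `|g (X w)| + `|h (X w)| <= m%:R.
    by rewrite ltW// truncnS_gt.
  exists m => //; split => /=; apply: le_trans mM; by rewrite ?lerDl ?lerDr.
have nd : nondecreasing_seq F.
  move=> a b ab; rewrite subsetEset => w [/= gb hb].
  by split => /=; [apply: le_trans gb _|apply: le_trans hb _]; rewrite ler_nat.
have cv : (\int[P]_(w in F i) ((y w - g (X w)) ^+ 2)%:E @[i --> \oo] -->
    \int[P]_(w in \bigcup_n F n) ((y w - g (X w)) ^+ 2)%:E)%E.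
  apply: ge0_nondecreasing_set_cvg_integral => //.
  - by move=> i; exact: measurable_funTS.
  - by move=> i w _; rewrite lee_fin sqr_ge0.
rewrite FT in cv; rewrite -(cvg_lim _ cv)//; apply: lime_le.
  by apply/cvg_ex; eexists; exact: cv.
by apply: nearW => n; exact: step.
Qed.

(** On a probability space the bound |U| <= U^2 + 1 has an integrable right-hand side. *)
Lemma integrable_sqr_integrable (U : Omega -> R) :
  measurable_fun [set: Omega] U ->
  (\int[P]_w (U w ^+ 2)%:E < +oo)%E ->
  P.-integrable [set: Omega] (EFin \o U).
Proof.
move=> mU fin.
have iU2 : P.-integrable [set: Omega] (fun w => (U w ^+ 2)%:E).
  apply/integrableP; split; first exact/measurable_EFinP/measurable_funX.
  by under eq_integral do rewrite /= ger0_norm ?sqr_ge0//.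
have i1 : P.-integrable [set: Omega] (cst 1%:E).
  exact: finite_measure_integrable_cst.
apply: (le_integrable measurableT _ _ (integrableD measurableT iU2 i1)).
  exact/measurable_EFinP.
move=> w _ /=; rewrite lee_fin [leRHS]ger0_norm ?addr_ge0 ?sqr_ge0//.
by rewrite ler_norml; apply/andP; split; nra.
Qed.

(* Perturbing by c 1_B with c the integral of U over the event X \in B gives
   0 <= -2 c^2 + c^2 P(X \in B) <= - c^2. *)
Lemma centered_of_optimal (U : Omega -> R) :
  measurable_fun [set: Omega] U ->
  (\int[P]_w (U w ^+ 2)%:E < +oo)%E ->
  (forall B s, measurable B ->
     (\int[P]_w (U w ^+ 2)%:E <= \int[P]_w ((U w - s * \1_B (X w)) ^+ 2)%:E)%E) ->
  centered P X U.
Proof.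
move=> mU fin opt.
have iU2 : P.-integrable [set: Omega] (fun w => (U w ^+ 2)%:E).
  apply/integrableP; split; first exact/measurable_EFinP/measurable_funX.
  by under eq_integral do rewrite /= ger0_norm ?sqr_ge0//.
have i1 : P.-integrable [set: Omega] (cst 1%:E).
  exact: finite_measure_integrable_cst.
have iU := integrable_sqr_integrable mU fin.
split => // B mB.
have mXB := measurable_preimage mX mB.
have iUB : P.-integrable (X @^-1` B) (EFin \o U) by exact: integrableS iU.
have fUB := integrable_fin_num mXB iUB.
pose c := fine (\int[P]_(w in X @^-1` B) (U w)%:E)%E.
have cE : (\int[P]_(w in X @^-1` B) (U w)%:E = c%:E)%E by rewrite fineK.
pose p := fine (P (X @^-1` B)).
have pE : P (X @^-1` B) = p%:E by rewrite fineK ?fin_num_measure.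
have p1 : p <= 1 by rewrite -lee_fin -pE probability_le1.
have := opt B c mB.
pose a := fine (\int[P]_w (U w ^+ 2)%:E)%E.
have aE : (\int[P]_w (U w ^+ 2)%:E = a%:E)%E.
  by rewrite fineK//; exact: integrable_fin_num iU2.
have iUB' : P.-integrable [set: Omega] (fun w => (U w * \1_B (X w))%:E).
  have := (integrable_mkcond (EFin \o U) mXB).1 iUB.
  by apply: eq_integrable => // w _; rewrite epatch_indic /= EFinM !indicE.
have iB : P.-integrable [set: Omega] (fun w => (\1_B (X w))%:E).
  have := (integrable_mkcond (cst 1%:E) mXB).1 (integrableS measurableT mXB (subsetT _) i1).
  by apply: eq_integrable => // w _; rewrite epatch_indic /= mul1e !indicE.
have E1 : (\int[P]_w (U w * \1_B (X w))%:E = c%:E)%E.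
  rewrite -cE [RHS]integral_mkcond; apply: eq_integral => w _.
  by rewrite epatch_indic /= EFinM !indicE.
have E2 : (\int[P]_w (\1_B (X w))%:E = p%:E)%E.
  rewrite -pE -[P _]mul1e -integral_cst// [RHS]integral_mkcond.
  by apply: eq_integral => w _; rewrite epatch_indic /= mul1e !indicE.
suff -> : (\int[P]_w ((U w - c * \1_B (X w)) ^+ 2)%:E =
    (a - 2 * c * c + c * c * p)%:E)%E.
  by rewrite aE lee_fin => H; rewrite cE; congr EFin; nra.
under eq_integral => w _.
  rewrite (_ : _ ^+ 2 = U w ^+ 2 - 2 * c * (U w * \1_B (X w)) + c * c * \1_B (X w)).
    rewrite EFinD EFinB (EFinM (2 * c)) (EFinM (c * c)). over.
  rewrite indicE; case: (X w \in B) => /=; ring.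
have i2 := integrableZl measurableT (2 * c) iUB'.
have i3 := integrableZl measurableT (c * c) iB.
rewrite integralD//=; last exact: (integrableB measurableT iU2 i2).
by rewrite (integralB measurableT iU2 i2) !integralZl//= E1 E2 aE.
Qed.

End optimality.

(** * Almost sure uniqueness *)

Section uniqueness.
Context (R : realType) (dO dT : measure_display) (Omega : measurableType dO)
  (T : measurableType dT) (P : probability Omega R).
Variable X : Omega -> T.
Hypothesis mX : measurable_fun [set: Omega] X.

Lemma centeredB (U V : Omega -> R) :
  centered P X U -> centered P X V -> centered P X (fun w => U w - V w).
Proof.
move=> [iU U0] [iV V0]; split=> [|B mB].
  by have := integrableB measurableT iU iV; apply: eq_integrable.
have mXB := measurable_preimage mX mB.
have iUB := integrableS measurableT mXB (subsetT _) iU.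
have iVB := integrableS measurableT mXB (subsetT _) iV.
by under eq_integral do rewrite EFinB; rewrite (integralB mXB iUB iVB)
  /= U0// V0// sube0.
Qed.

(* Tested against the sign of k, the hypothesis says that |k(X)| integrates to
   zero. *)
Lemma centered_comp_eq0 (k : T -> R) : measurable_fun [set: T] k ->
  centered P X (fun w => k (X w)) -> {ae P, forall w, k (X w) = 0}.
Proof.
move=> mk ck; have [ik _] := ck.
have ms : measurable_fun [set: T] (fun t => Num.sg (k t)).
  rewrite (_ : (fun t => _) = fun t => (if 0 < k t then 1 else if k t < 0 then -1 else 0)).
    apply: measurable_fun_ifT => //; last first.
      by apply: measurable_fun_ifT => //; exact: measurable_fun_ltr.
    exact: measurable_fun_ltr.
  by apply/funext => t; case: sgrP.
have sg1 t : `|Num.sg (k t)| <= 1 by rewrite normr_sg; case: (k t != 0).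
have [_ ] := centered_bounded mX ck ms sg1.
under eq_integral do rewrite -normrEsg.
move=> I0.
have : ae_eq P setT (fun w => (k (X w))%:E) (cst 0%E).
  exact/(ae_eq_integral_abs P measurableT (measurable_int _ ik)).1.
by apply: filterS => w /(_ Logic.I)[].
Qed.

Lemma centered_ae_eq (U V : Omega -> R) : measurable_fun [set: Omega] V ->
  {ae P, forall w, U w = V w} -> centered P X U -> centered P X V.
Proof.
move=> mV UV [iU U0].
have mU : measurable_fun [set: Omega] (EFin \o U) := measurable_int _ iU.
have mV' : measurable_fun [set: Omega] (EFin \o V) by exact/measurable_EFinP.
split.
  apply/integrableP; split => //.
  have /integrableP[_] := iU; congr (_ < _)%E.
  apply: ge0_ae_eq_integral => //; try exact: measurableT_comp.
  by apply: filterS UV => w /= -> _.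
move=> B mB; rewrite -(U0 _ mB); have mXB := measurable_preimage mX mB.
apply: ae_eq_integral => //; try exact: measurable_funTS.
by apply: filterS UV => w /= -> _.
Qed.

End uniqueness.

(** * Squared error of vectors, coordinate by coordinate *)

Section vector.
Context (R : realType) (dO dT : measure_display) (Omega : measurableType dO)
  (T : measurableType dT) (P : probability Omega R) (d : nat).
Implicit Types (Y : Omega -> d.-tuple R) (g h : T -> d.-tuple R).

Lemma expectation_sqdist Y (Z : Omega -> d.-tuple R) :
  measurable_fun [set: Omega] Y -> measurable_fun [set: Omega] Z ->
  ('E_P[fun w => sqdist (Y w) (Z w)] =
   \sum_(i < d) \int[P]_w ((tnth (Y w) i - tnth (Z w) i) ^+ 2)%:E)%E.
Proof.
move=> /measurable_fun_tnthP mY /measurable_fun_tnthP mZ.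
rewrite unlock /sqdist; under eq_integral do rewrite /= -sumEFin.
rewrite ge0_integral_sum// => i.
  by apply/measurable_EFinP/measurable_funX/measurable_funB; [exact: mY|exact: mZ].
by move=> w _; rewrite lee_fin sqr_ge0.
Qed.

Variable X : Omega -> T.
Hypothesis mX : measurable_fun [set: Omega] X.

Definition residual Y g i w := tnth (Y w) i - tnth (g (X w)) i.

Lemma mse_le_of_centered Y g h : measurable_fun [set: Omega] Y ->
  measurable_fun [set: T] g -> measurable_fun [set: T] h ->
  (forall i, centered P X (residual Y g i)) ->
  ('E_P[fun w => sqdist (Y w) (g (X w))] <= 'E_P[fun w => sqdist (Y w) (h (X w))])%E.
Proof.
move=> mY mg mh c.
rewrite !expectation_sqdist//; [|exact: measurableT_comp..].
apply: lee_sum => i _.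
move/measurable_fun_tnthP : mY => mY.
move/measurable_fun_tnthP : mg => mg.
move/measurable_fun_tnthP : mh => mh.
exact: (centered_optimal mX (mY i) (mg i) (mh i) (c i)).
Qed.

(** Perturbing only coordinate i by s 1_B leaves the errors of the other coordinates unchanged.
    These are finite, hence cancel, and the scalar criterion applies to coordinate i. *)
Lemma centered_of_mse_le Y g : measurable_fun [set: Omega] Y ->
  measurable_fun [set: T] g ->
  ('E_P[fun w => sqdist (Y w) (g (X w))] < +oo)%E ->
  (forall h, measurable_fun [set: T] h ->
  ('E_P[fun w => sqdist (Y w) (g (X w))] <=
   'E_P[fun w => sqdist (Y w) (h (X w))])%E) ->
  forall i, centered P X (residual Y g i).
Proof.
move=> mY mg fin opt i.
have mgX : measurable_fun [set: Omega] (fun w => g (X w)).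
  exact: measurableT_comp.
have mU j : measurable_fun [set: Omega] (residual Y g j).
  apply: measurable_funB; first exact/(measurable_fun_tnthP _).1.
  exact: ((measurable_fun_tnthP _).1 mgX).
move: fin; rewrite expectation_sqdist// (bigD1 i)//=.
set rest := (X in (_ + X)%E).
have rest0 : (0 <= rest)%E.
  by apply: sume_ge0 => j _; apply: integral_ge0 => w _; rewrite lee_fin sqr_ge0.
move=> fin.
have Uoo : (\int[P]_w (residual Y g i w ^+ 2)%:E < +oo)%E.
  by apply: le_lt_trans fin; rewrite leeDl.
have restoo : rest \is a fin_num.
  rewrite ge0_fin_numE//; apply: le_lt_trans fin; rewrite leeDr//.
  by apply: integral_ge0 => w _; rewrite lee_fin sqr_ge0.
apply: centered_of_optimal => // B s mB.
pose h t := [tuple tnth (g t) j + (if j == i then s * \1_B t else 0) | j < d].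
have mh : measurable_fun [set: T] h.
  apply/measurable_fun_tnthP => j.
  rewrite (_ : _ \o _ = fun t => tnth (g t) j + (if j == i then s * \1_B t else 0)).
    apply: measurable_funD; first exact: ((measurable_fun_tnthP _).1 mg).
    by case: (j == i) => //; exact: measurable_funM.
  by apply/funext => t /=; rewrite tnth_mktuple.
have := opt h mh.
rewrite !expectation_sqdist//; last exact: measurableT_comp.
rewrite (bigD1 i)//= [leRHS](bigD1 i)//=.
rewrite [X in (_ + X)%E](_ : _ = rest)// [X in (_ <= _ + X)%E](_ : _ = rest); last first.
  apply: eq_bigr => j ji; apply: eq_integral => w _.
  by rewrite tnth_mktuple (negbTE ji) addr0.
rewrite leeD2rE//; move/le_trans; apply.
rewrite le_eqVlt; apply/orP; left; apply/eqP; apply: eq_integral => w _.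
by rewrite tnth_mktuple eqxx /residual; congr (EFin (_ ^+ 2)); ring.
Qed.

End vector.

(** * Disintegration over an independent time *)

Definition RV_of (R : realType) (d1 d2 : measure_display)
    (Omega : measurableType d1) (T : measurableType d2) (P : probability Omega R)
    (X : Omega -> T) (mX : measurable_fun [set: Omega] X) : {RV P >-> T} :=
  HB.pack X (isMeasurableFun.Build _ _ _ _ X mX).

(* Unlike integral_distribution, integrability is not assumed: when the positive
   and negative parts both have infinite integral the two sides still agree. *)
Lemma integral_distributionT (R : realType) (d1 d2 : measure_display)
    (Omega : measurableType d1) (T : measurableType d2) (P : probability Omega R)
    (X : {RV P >-> T}) (f : T -> \bar R) :
  measurable_fun [set: T] f ->
  (\int[distribution P X]_y f y = \int[P]_w f (X w))%E.
Proof.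
move=> mf; rewrite integralE [RHS]integralE.
congr (_ - _)%E; rewrite ge0_integral_distribution//.
- by apply: eq_integral => w _; rewrite -funepos_comp.
- exact: measurable_funepos.
- by apply: eq_integral => w _; rewrite -funeneg_comp.
- exact: measurable_funeneg.
Qed.

Section independence.
Context (R : realType) (dO d1 d2 : measure_display) (Omega : measurableType dO)
  (T1 : measurableType d1) (T2 : measurableType d2) (P : probability Omega R).
Variables (tau : {RV P >-> T1}) (Z : {RV P >-> T2}).
Hypothesis tauZ : independent_RVs P tau Z.
Local Notation m1 := (distribution P tau).
Local Notation m2 := (distribution P Z).

Let mtauZ : measurable_fun [set: Omega] (fun w => (tau w, Z w)).
Proof. exact: measurable_fun_pair. Qed.
Let V : {RV P >-> (T1 * T2)%type} := RV_of P mtauZ.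

(** Independence makes the joint law agree with the product law on rectangles, which determines the
    product measure. *)
Let product_lawE (f : T1 * T2 -> \bar R) :
  (\int[m1 \x m2]_z f z = \int[distribution P V]_z f z)%E.
Proof.
apply: eq_measure_integral => A mA _.
by apply: product_measure_unique.
Qed.

Lemma ge0_fubini_independent (f : T1 * T2 -> \bar R) :
  measurable_fun [set: T1 * T2] f -> (forall z, 0 <= f z)%E ->
  (\int[P]_w f (tau w, Z w) = \int[m1]_t \int[P]_w f (t, Z w))%E.
Proof.
move=> mf f0; rewrite -(ge0_integral_distribution V)//.
rewrite -product_lawE fubini_tonelli1//.
apply: eq_integral => t _; rewrite /fubini_F ge0_integral_distribution//.
exact: measurable_fun_pair2.
Qed.

(** Integrability on [Omega] is integrability for the product of the laws. Fubini applies there, and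
    the inner integrals are pulled back to [Omega] with the time frozen at t. *)
Lemma fubini_independent (f : T1 * T2 -> \bar R) :
  measurable_fun [set: T1 * T2] f ->
  P.-integrable [set: Omega] (fun w => f (tau w, Z w)) ->
  [/\ m1.-integrable [set: T1] (fun t => \int[P]_w f (t, Z w))%E,
      {ae m1, forall t, P.-integrable [set: Omega] (fun w => f (t, Z w))} &
      (\int[m1]_t \int[P]_w f (t, Z w) = \int[P]_w f (tau w, Z w))%E].
Proof.
move=> mf /integrableP[_ ioo].
have mft t : measurable_fun [set: T2] (fun z => f (t, z)).
  exact: measurable_fun_pair2.
have intf : (m1 \x m2)%E.-integrable [set: T1 * T2] f.
  apply/integrableP; split => //; rewrite product_lawE ge0_integral_distribution//.
  exact: measurableT_comp.
have FE : fubini_F m2 f = (fun t => \int[P]_w f (t, Z w))%E.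
  by apply/funext => t; rewrite /fubini_F integral_distributionT.
split.
- by rewrite -FE; exact: integrable_fubini_F.
- apply: filterS (ae_integrable1 intf) => t /integrableP[_ itoo].
  apply/integrableP; split; first exact: (measurableT_comp (mft t)).
  rewrite ge0_integral_distribution// in itoo; exact: measurableT_comp.
- by rewrite -FE integral12_prod_meas1// product_lawE integral_distributionT.
Qed.

End independence.

(** The events over which U integrates to zero form a Dynkin class: complements are covered because
    the total integral is 0, disjoint unions because U is integrable. The pi-system G then yields
    all events. *)
Lemma centered_generator (R : realType) (dO dT : measure_display)
    (Omega : measurableType dO) (T : measurableType dT) (P : probability Omega R)
    (X : Omega -> T) (G : set (set T)) (U : Omega -> R) :
  measurable_fun [set: Omega] X ->
  @measurable _ T = <<s G >> -> setI_closed G -> G [set: T] ->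
  P.-integrable [set: Omega] (EFin \o U) ->
  (forall B, G B -> (\int[P]_(w in X @^-1` B) (U w)%:E = 0)%E) ->
  centered P X U.
Proof.
move=> mX GE GI GT iU G0; split => // B; rewrite GE.
have T0 : (\int[P]_w (U w)%:E = 0)%E by have := G0 _ GT; rewrite preimage_setT.
have iUS B' : measurable B' -> P.-integrable (X @^-1` B') (EFin \o U).
  move=> mB'; apply: (integrableS measurableT) => //; exact: measurable_preimage.
apply: (dynkin_induction (P := fun B => (\int[P]_(w in X @^-1` B) (U w)%:E = 0)%E)
  GE GI) => //.
- move=> S mS S0; have mXS := measurable_preimage mX mS.
  have := T0; rewrite -(setvU (X @^-1` S)) integral_setU ?S0 ?adde0//.
  + exact: measurableC.
  + by apply: measurable_funTS; exact: measurable_int iU.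
  + by apply/disj_setPS; rewrite setICl.
- move=> F mF tF F0; rewrite preimage_bigcup integral_bigcup//.
  + by rewrite eseries0.
  + apply/trivIsetP => i j _ _ ij.
    by rewrite -preimage_setI (trivIsetP.1 tF)// preimage_set0.
  + by move=> k; exact: measurable_preimage.
  + by rewrite -preimage_bigcup; apply: iUS; exact: bigcup_measurable.
Qed.

(** * A countable pi-system generating the events of R^d *)

Section boxes.
Context (R : realType) (d : nat).

(* Indexing by lists of constraints makes stability under intersection mere
   concatenation, and includes the full space as the empty list. *)
Definition rat_box (s : seq ('I_d * rat)) : set (d.-tuple R) :=
  [set y | forall p, p \in s -> tnth y p.1 <= ratr p.2].

Lemma rat_boxI s1 s2 : rat_box s1 `&` rat_box s2 = rat_box (s1 ++ s2).
Proof.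
apply/seteqP; split => [y [y1 y2] p|y h].
  by rewrite mem_cat => /orP[/y1|/y2].
by split => p ps; apply: h; rewrite mem_cat ps ?orbT.
Qed.

Lemma rat_box_nil : rat_box [::] = setT.
Proof. by apply/seteqP; split. Qed.

Lemma measurable_rat_box s : measurable (rat_box s).
Proof.
elim: s => [|p s IH]; first by rewrite rat_box_nil.
rewrite -cat1s -rat_boxI; apply: measurableI => //.
rewrite (_ : rat_box [:: p] = setT `&` (@tnth _ _)^~ p.1 @^-1` `]-oo, ratr p.2]%classic).
  exact: measurable_tnth.
rewrite setTI; apply/seteqP; split => y /=; rewrite in_itv /=.
  by apply; rewrite mem_head.
by move=> h q; rewrite mem_seq1 => /eqP ->.
Qed.

Lemma rat_box_generate : @measurable _ (d.-tuple R) = <<s range rat_box >>.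
Proof.
apply/seteqP; split; last first.
  apply: smallest_sub; first exact: sigma_algebra_measurable.
  by move=> _ [s _ <-]; exact: measurable_rat_box.
(* The remaining inclusion is the measurability of the identity from R^d carrying the sigma-algebra
   generated by the boxes. *)
pose GT := g_sigma_algebraType (range rat_box).
have mid : measurable_fun [set: GT] (id : GT -> d.-tuple R).
  apply/measurable_fun_tnthP => i.
  apply: (@measurability _ _ GT R _ _ (@RGenOInfty.G R)).
    exact: RGenOInfty.measurableE.
  move=> _ [_ [x ->] <-]; rewrite setTI.
  (* A coordinate exceeds x exactly when it exceeds some rational q >= x, and exceeding q is the
     complement of a one-constraint box. *)
  rewrite (_ : _ @^-1` _ =
    \bigcup_(q : rat) (if x <= ratr q then ~` rat_box [:: (i, q)] else set0)).
    apply: bigcupT_measurable_rat => q; case: ifP => // _.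
    by apply: measurableC; apply: sub_sigma_algebra; exists [:: (i, q)].
  apply/seteqP; split => y /=.
    rewrite in_itv /= andbT => xy; have [q] := rat_in_itvoo xy.
    rewrite in_itv /= => /andP[xq qy]; exists q => //; rewrite ltW//=.
    by move=> /(_ (i, q) (mem_head _ _)) /=; rewrite leNgt qy.
  move=> [q _]; case: ifP => // xq /= nb; rewrite in_itv /= andbT ltNge.
  apply/negP => yx; apply: nb => p; rewrite mem_seq1 => /eqP -> /=.
  exact: le_trans xq.
by move=> A mA; have := mid measurableT A mA; rewrite setTI.
Qed.

End boxes.

(** * From the joint observation to almost every fixed time *)

Section slices.
Context (R : realType) (dO d1 d2 : measure_display) (Omega : measurableType dO)
  (T1 : measurableType d1) (T2 : measurableType d2) (P : probability Omega R)
  (d : nat).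
Variables (tau : {RV P >-> T1}) (Z : {RV P >-> T2}).
Hypothesis tauZ : independent_RVs P tau Z.
Variables (X : T1 * T2 -> d.-tuple R) (U : T1 * T2 -> R).
Hypotheses (mX : measurable_fun [set: T1 * T2] X)
  (mU : measurable_fun [set: T1 * T2] U).

Lemma centered_slices :
  centered P (fun w => (X (tau w, Z w), tau w)) (fun w => U (tau w, Z w)) ->
  {ae distribution P tau, forall t,
    centered P (fun w => X (t, Z w)) (fun w => U (t, Z w))}.
Proof.
move=> [iU U0].
have mtZ : measurable_fun [set: Omega] (fun w => (tau w, Z w)).
  exact: measurable_fun_pair.
have mXt t : measurable_fun [set: Omega] (fun w => X (t, Z w)).
  by apply: (measurableT_comp mX); exact: measurable_fun_pair.
have mXj : measurable_fun [set: Omega] (fun w => (X (tau w, Z w), tau w)).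
  by apply: measurable_fun_pair => //; exact: (measurableT_comp mX).
have meU : measurable_fun [set: T1 * T2] (EFin \o U) by exact/measurable_EFinP.
have [_ ae_int _] := fubini_independent tauZ meU iU.
pose phi s t := (\int[P]_(w in (fun w => X (t, Z w)) @^-1` rat_box s) (U (t, Z w))%:E)%E.
(* This restricts U to the observation lying in the box and the time lying in C. Its integral at
   frozen t is [phi s t] for t in C and 0 otherwise. *)
pose f s C (z : T1 * T2) := (U z * \1_(rat_box s `*` C) (X z, z.1))%:E.
have mf s C : measurable C -> measurable_fun [set: T1 * T2] (f s C).
  move=> mC; apply/measurable_EFinP/measurable_funM => //.
  have mBC : measurable (rat_box (R:=R) (d:=d) s `*` C).
    by apply: measurableX => //; exact: measurable_rat_box.
  have mXz : measurable_fun [set: T1 * T2] (fun z => (X z, z.1)).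
    exact: measurable_fun_pair.
  have mI : measurable_fun setT (\1_(rat_box s `*` C) : d.-tuple R * T1 -> R).
    exact: measurable_indic.
  exact: (measurableT_comp mI mXz).
have if0 s C : measurable C ->
    P.-integrable [set: Omega] (fun w => f s C (tau w, Z w)) /\
    (\int[P]_w f s C (tau w, Z w) = 0)%E.
  move=> mC; have mBC : measurable (rat_box (R:=R) (d:=d) s `*` C).
    by apply: measurableX => //; exact: measurable_rat_box.
  have mp := measurable_preimage mXj mBC.
  have e w : f s C (tau w, Z w) =
      ((EFin \o (fun w => U (tau w, Z w)))
        \_ ((fun w => (X (tau w, Z w), tau w)) @^-1` (rat_box s `*` C))) w.
    by rewrite epatch_indic /= /f EFinM !indicE.
  split.
    have := (integrable_mkcond _ mp).1 (integrableS measurableT mp (subsetT _) iU).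
    by apply: eq_integrable => // w _; rewrite e.
  under eq_integral do rewrite e.
  by rewrite -integral_mkcond; exact: U0.
have phiE s C t : (\int[P]_w f s C (t, Z w) = (phi s \_ C) t)%E.
  rewrite patchE; case: ifPn => tC.
    rewrite /phi [RHS]integral_mkcond; apply: eq_integral => w _.
    rewrite epatch_indic /= /f EFinM !indicE /=; congr (_ * (_ %:R)%:E)%E.
    congr nat_of_bool; apply/idP/idP => /set_mem.
      by move=> [? ?]; exact/mem_set.
    by move=> ?; apply/mem_set; split => //; exact/set_mem.
  rewrite -[RHS](integral0 P setT); apply: eq_integral => w _.
  rewrite /f indicE memNset ?mulr0// => -[_ /=] ?.
  by move/negP : tC; apply; exact/mem_set.
have iphi s : (distribution P tau).-integrable [set: T1] (phi s).
  have [i _] := if0 s _ measurableT.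
  have [+ _ _] := fubini_independent tauZ (mf s _ measurableT) i.
  by apply: eq_integrable => // t _; rewrite phiE patch_setT.
(* By Fubini [phi s] integrates to zero over every measurable set C of times, so it vanishes almost
   everywhere. *)
have phi0 s : {ae distribution P tau, forall t, phi s t = 0%E}.
  have : ae_eq (distribution P tau) setT (phi s) (cst 0%E).
    apply: integral_ae_eq => // C _ mC; rewrite integral0.
    have [i <-] := if0 s _ mC.
    have [_ _ <-] := fubini_independent tauZ (mf s _ mC) i.
    by rewrite integral_mkcond; apply: eq_integral => t _; rewrite phiE.
  by apply: filterS => t /(_ Logic.I).
(* Lists of rational constraints are countable; running over their codes n merges the exceptional
   sets into a single null set. *)
have all_phi0 : {ae distribution P tau, forall t, forall n : nat,
    forall s : seq ('I_d * rat), choice.unpickle n = Some s -> phi s t = 0%E}.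
  apply: ae_foralln => n; case: (choice.unpickle n) => [s|]; last exact: aeW.
  by apply: filterS (phi0 s) => t ? _ [<-].
near=> t.
apply: (centered_generator (mXt t) (rat_box_generate R d)).
- by move=> _ _ [s1 _ <-] [s2 _ <-]; exists (s1 ++ s2); rewrite ?rat_boxI.
- by exists [::] => //; rewrite rat_box_nil.
- by near: t; exact: ae_int.
- move=> _ [s _ <-].
  have : forall (n : nat) (s : seq ('I_d * rat)),
    choice.unpickle n = Some s -> phi s t = 0%E by near: t; exact: all_phi0.
  by move=> /(_ (choice.pickle s) s); apply; rewrite choice.pickleK.
Unshelve. all: by end_near.
Qed.

End slices.

(** * Second moment of the Gaussian *)

Section gaussian.
Context (R : realType).
Local Notation mu := (@lebesgue_measure R).

(** The Radon-Nikodym derivative and the Gaussian density have the same integral over every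
    measurable set, so they agree almost everywhere and may be exchanged in the change of
    variables. *)
Lemma ge0_integral_normal_prob (m s : R) (f : R -> \bar R) :
  (forall x, 0 <= f x)%E -> measurable_fun [set: R] f ->
  (\int[normal_prob m s]_x f x = \int[mu]_x (f x * (normal_pdf m s x)%:E))%E.
Proof.
move=> f0 mf; have dom := normal_prob_dominates m s.
rewrite -(Radon_Nikodym_SigmaFinite.change_of_variables dom)//.
have RNpdf : ae_eq mu setT (Radon_Nikodym_SigmaFinite.f (normal_prob m s) mu)
    (fun x => (normal_pdf m s x)%:E).
  apply: integral_ae_eq => //.
  - exact: Radon_Nikodym_SigmaFinite.f_integrable.
  - apply/measurable_EFinP; exact: measurable_normal_pdf.
  - by move=> E _ mE; rewrite -Radon_Nikodym_SigmaFinite.f_integral.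
apply: ge0_ae_eq_integral => //.
- apply: emeasurable_funM => //.
  exact: measurable_int (Radon_Nikodym_SigmaFinite.f_integrable dom).
- by apply: emeasurable_funM => //; apply/measurable_EFinP; exact: measurable_normal_pdf.
- by move=> x _; rewrite mule_ge0// Radon_Nikodym_SigmaFinite.f_ge0.
- by move=> x _; rewrite mule_ge0// lee_fin normal_pdf_ge0.
- exact: ae_eqe_mul2l.
Qed.

(* x^2 times the density of N(0, 1) is at most a multiple of the density of
   N(0, 4), because y <= exp y for y = 3/8 x^2. *)
Lemma normal_second_moment_lty : (\int[normal_prob (0 : R) 1]_x (x ^+ 2)%:E < +oo)%E.
Proof.
have mX2 : measurable_fun [set: R] (fun x : R => (x ^+ 2)%:E).
  exact/measurable_EFinP/measurable_funX.
rewrite ge0_integral_normal_prob//; last by move=> x; rewrite lee_fin sqr_ge0.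
(* The factor 8/3 comes from x^2 = 8/3 (3/8 x^2), where 3/8 = 1/2 - 1/8 is the gap between the two
   exponents; the peaks trade one normalization for the other. *)
pose C : R := normal_peak 1 * (8 / 3) * (normal_peak 2)^-1.
have C0 : 0 <= C by rewrite !mulr_ge0 ?invr_ge0 ?normal_peak_ge0.
apply: (@le_lt_trans _ _ (\int[mu]_x (C%:E * (normal_pdf 0 2 x)%:E))%E); last first.
  rewrite integralZl//; last exact: integrable_normal_pdf.
  by rewrite integral_normal_pdf mule1 ltry.
apply: ge0_le_integral => //.
- by move=> x _; rewrite -EFinM lee_fin mulr_ge0 ?sqr_ge0 ?normal_pdf_ge0.
- by apply: emeasurable_funM => //; apply/measurable_EFinP; exact: measurable_normal_pdf.
- by apply: emeasurable_funM => //; apply/measurable_EFinP; exact: measurable_normal_pdf.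
move=> x _; rewrite -!EFinM lee_fin !normal_pdfE// /normal_fun !subr0.
have e : expR (- x ^+ 2 / (1 ^+ 2 *+ 2)) * expR (3 / 8 * x ^+ 2) =
    expR (- x ^+ 2 / (2 ^+ 2 *+ 2)) :> R.
  by rewrite -expRD; congr expR; field.
have h : 3 / 8 * x ^+ 2 <= expR (3 / 8 * x ^+ 2).
  by apply: le_trans (expR_ge1Dx _); rewrite lerDr.
rewrite -e /C.
have p2 : (normal_peak 2)^-1 * normal_peak 2 = 1 :> R.
  by rewrite mulVf// gt_eqF// normal_peak_gt0.
set a := expR (- _ / _); set b := expR _ in h *; set p := normal_peak 1.
rewrite [leRHS](_ : _ = p * a * (8 / 3 * b) * ((normal_peak 2)^-1 * normal_peak 2)).
  rewrite p2 mulr1 [leLHS](_ : _ = p * a * x ^+ 2); last by ring.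
  apply: ler_wpM2l; first by rewrite mulr_ge0 ?normal_peak_ge0 ?expR_ge0.
  by lra.
by ring.
Qed.

Lemma std_gaussian_second_moment_lty (dO : measure_display)
    (Omega : measurableType dO) (P : probability Omega R) (d : nat)
    (Y : Omega -> d.-tuple R) (i : 'I_d) :
  measurable_fun [set: Omega] Y -> std_gaussian P Y ->
  (\int[P]_w (tnth (Y w) i ^+ 2)%:E < +oo)%E.
Proof.
move=> /measurable_fun_tnthP mY gY.
(* The marginal law comes from the box with side A in coordinate i and the full line in the
   others. *)
have law (A : set R) : measurable A ->
    pushforward P (fun w => tnth (Y w) i) A = normal_prob 0 1 A.
  move=> mA; rewrite /pushforward.
  have := gY (fun j => if j == i then A else setT).
  rewrite (bigD1 i)//= eqxx big1 ?mule1; last first.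
    by move=> j /negbTE ->; exact: probability_setT.
  move=> <-; last by move=> j; case: (j == i).
  congr (P _); apply/seteqP; split => w /=.
    by move=> Aw j; case: eqP => // ->.
  by move=> /(_ i); rewrite eqxx.
rewrite (_ : (\int[P]_w _)%E = \int[normal_prob (0 : R) 1]_x (x ^+ 2)%:E)%E.
  exact: normal_second_moment_lty.
have mYi : measurable_fun [set: Omega]
  ((fun w => tnth (Y w) i) : Omega -> measurableTypeR R) by exact: mY.
rewrite -(@ge0_integral_pushforward _ _ _ (measurableTypeR R) _ _ mYi P setT
  (fun x => (x ^+ 2)%:E))//.
- by apply: eq_measure_integral => A mA _; exact: law.
- by apply/measurable_EFinP; exact: measurable_funX.
- by move=> x _; rewrite lee_fin sqr_ge0.
Qed.

End gaussian.

(** * Mean squared error and conditional expectation *)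

Section mmse.
Context (R : realType) (dO dT : measure_display) (Omega : measurableType dO)
  (T : measurableType dT) (P : probability Omega R) (d : nat).
Variables (Y : Omega -> d.-tuple R) (X : Omega -> T).
Hypotheses (mY : measurable_fun [set: Omega] Y) (mX : measurable_fun [set: Omega] X)
  (Y2 : forall i, (\int[P]_w (tnth (Y w) i ^+ 2)%:E < +oo)%E).

(** An optimal g does at least as well as the zero predictor, whose error is finite by the second
    moments of Y; finiteness is what the perturbation argument requires. *)
Lemma mmseP (g : T -> d.-tuple R) : measurable_fun [set: T] g ->
  (forall h, measurable_fun [set: T] h ->
    ('E_P[fun w => sqdist (Y w) (g (X w))] <=
     'E_P[fun w => sqdist (Y w) (h (X w))])%E) <->
  (forall i, centered P X (residual X Y g i)).
Proof.
move=> mg; split => [opt|c h mh]; last exact: mse_le_of_centered.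
apply: centered_of_mse_le => //.
have m0 : measurable_fun [set: T] (fun _ : T => [tuple 0 : R | i < d]) by [].
apply: le_lt_trans (opt _ m0) _.
rewrite expectation_sqdist//; apply/lte_sum_pinfty => i _.
by under eq_integral do rewrite tnth_mktuple subr0.
Qed.

End mmse.

Section cond_expectation.
Context (R : realType) (dO : measure_display) (Omega : measurableType dO)
  (P : probability Omega R) (d : nat).
Variables (Y X : Omega -> d.-tuple R).
Hypotheses (mX : measurable_fun [set: Omega] X)
  (iY : integrable_vector P Y).

(** As Y is integrable, g(X) is integrable exactly when the residual is, and linearity of the
    integral over each event of X converts one condition into the other. *)
Lemma is_cond_expectationP (g : d.-tuple R -> d.-tuple R) :
  is_cond_expectation P Y X g <->
  measurable_fun [set: d.-tuple R] g /\ forall i, centered P X (residual X Y g i).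
Proof.
split=> [[mg ig gY]|[mg c]].
  split=> // i; split.
    by have := integrableB measurableT (iY i) (ig i); apply: eq_integrable.
  move=> B mB; have mXB := measurable_preimage mX mB.
  have iYB := integrableS measurableT mXB (subsetT _) (iY i).
  have igB := integrableS measurableT mXB (subsetT _) (ig i).
  rewrite /residual; under eq_integral do rewrite EFinB.
  rewrite (integralB mXB iYB igB) /= -[X in (X - _)%E](gY i B mB) subee//.
  exact: (integrable_fin_num mXB igB).
have gE i w : (tnth (g (X w)) i)%:E =
    ((tnth (Y w) i)%:E - (residual X Y g i w)%:E)%E.
  by rewrite -EFinB /residual; congr EFin; ring.
split=> // [i|i B mB].
  have [ic _] := c i.
  have := integrableB measurableT (iY i) ic.
  by apply: eq_integrable => // w _; rewrite gE.
have mXB := measurable_preimage mX mB.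
have [ic c0] := c i.
have iYB := integrableS measurableT mXB (subsetT _) (iY i).
have icB := integrableS measurableT mXB (subsetT _) ic.
under eq_integral do rewrite gE.
by rewrite (integralB mXB iYB icB) /= c0// sube0.
Qed.

End cond_expectation.

(** * Denoising and the planner's problem at a fixed time *)

Section planner.
Context (R : realType) (dO : measure_display) (Omega : measurableType dO)
  (P : probability Omega R) (d : nat).
Local Notation V := (d.-tuple R).

Lemma planner_solutionsE (x0 xt : Omega -> V) :
  planner_solutions P x0 xt = argmin (@decision_rules R d) (mse P x0 xt).
Proof.
by apply/seteqP; split => f [Df H]; split => // g /H; rewrite leeN2.
Qed.

(** The solution e of y = a v + s e: for nonzero a and s, the inverse of [denoise a s y]. *)
Definition noise (a s : R) (y v : V) : V :=
  [tuple s^-1 * (tnth y i - a * tnth v i) | i < d].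

Lemma denoiseK (a s : R) (y v : V) : a != 0 -> s != 0 ->
  noise a s y (denoise a s y v) = v.
Proof.
move=> a0 s0; apply: eq_from_tnth => i; rewrite !tnth_mktuple.
by field; rewrite a0 s0.
Qed.

Lemma noiseK (a s : R) (y v : V) : a != 0 -> s != 0 ->
  denoise a s y (noise a s y v) = v.
Proof.
move=> a0 s0; apply: eq_from_tnth => i; rewrite !tnth_mktuple.
by field; rewrite a0 s0.
Qed.

(** The coefficients may vary with the point, which covers observations whose schedule is evaluated
    at a random time. *)
Lemma measurable_tuple_linear (dT : measure_display) (T : measurableType dT)
    (a b : T -> R) (u v : T -> V) :
  measurable_fun [set: T] a -> measurable_fun [set: T] b ->
  measurable_fun [set: T] u -> measurable_fun [set: T] v ->
  measurable_fun [set: T]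
    (fun t => [tuple a t * tnth (u t) i + b t * tnth (v t) i | i < d]).
Proof.
move=> ma mb /measurable_fun_tnthP mu /measurable_fun_tnthP mv.
apply/measurable_fun_tnthP => i.
rewrite (_ : _ \o _ = fun t => a t * tnth (u t) i + b t * tnth (v t) i).
  by apply: measurable_funD; apply: measurable_funM => //; [exact: mu|exact: mv].
by apply/funext => t /=; rewrite tnth_mktuple.
Qed.

Lemma measurable_denoise (a s : R) (f : V -> V) : measurable_fun [set: V] f ->
  measurable_fun [set: V] (fun y => denoise a s y (f y)).
Proof.
move=> mf.
have : measurable_fun [set: V]
    (fun y => [tuple a^-1 * tnth y i + (- (a^-1 * s)) * tnth (f y) i | i < d]).
  by apply: measurable_tuple_linear => //; exact: measurable_cst.
congr measurable_fun; apply/funext => y; apply: eq_from_tnth => i.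
by rewrite !tnth_mktuple /=; ring.
Qed.

Lemma measurable_noise (a s : R) (f : V -> V) : measurable_fun [set: V] f ->
  measurable_fun [set: V] (fun y => noise a s y (f y)).
Proof.
move=> mf.
have : measurable_fun [set: V]
    (fun y => [tuple s^-1 * tnth y i + (- (s^-1 * a)) * tnth (f y) i | i < d]).
  by apply: measurable_tuple_linear => //; exact: measurable_cst.
congr measurable_fun; apply/funext => y; apply: eq_from_tnth => i.
by rewrite !tnth_mktuple /=; ring.
Qed.

Variables (x0 eps : Omega -> V).
Hypotheses (mx0 : measurable_fun [set: Omega] x0)
  (meps : measurable_fun [set: Omega] eps).
Variables (a s : R).
Hypothesis a0 : a != 0.
Let xt w := forward a s (x0 w) (eps w).

Lemma measurable_forward : measurable_fun [set: Omega] xt.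
Proof.
exact: (measurable_tuple_linear (measurable_cst a) (measurable_cst s)).
Qed.

Lemma measurable_sqdist (u v : Omega -> V) :
  measurable_fun [set: Omega] u -> measurable_fun [set: Omega] v ->
  measurable_fun [set: Omega] (fun w => sqdist (u w) (v w)).
Proof.
move=> /measurable_fun_tnthP mu /measurable_fun_tnthP mv.
apply: measurable_sum => i; apply: measurable_funX.
by apply: measurable_funB; [exact: mu|exact: mv].
Qed.

Lemma sqdist_ge0 (u v : V) : 0 <= sqdist u v.
Proof. by apply: sumr_ge0 => i _; exact: sqr_ge0. Qed.

Lemma mse_denoise (f : V -> V) : measurable_fun [set: V] f ->
  (mse P x0 xt (fun y => denoise a s y (f y)) =
   ((s / a) ^+ 2)%:E * 'E_P[fun w => sqdist (eps w) (f (xt w))])%E.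
Proof.
move=> mf; rewrite /mse unlock -ge0_integralZl//.
- apply: eq_integral => w _; rewrite -EFinM /sqdist mulr_sumr; congr EFin.
  apply: eq_bigr => i _; rewrite !tnth_mktuple.
  by field.
- apply/measurable_EFinP/measurable_sqdist => //.
  by apply: (measurableT_comp mf); exact: measurable_forward.
- by move=> w _; rewrite lee_fin sqdist_ge0.
- by rewrite lee_fin sqr_ge0.
Qed.

End planner.

Section implements.
Context (R : realType) (dO : measure_display) (Omega : measurableType dO)
  (P : probability Omega R) (d : nat).
Local Notation V := (d.-tuple R).
Variables (x0 eps : Omega -> V).
Hypotheses (mx0 : measurable_fun [set: Omega] x0)
  (meps : measurable_fun [set: Omega] eps)
  (eps2 : forall i, (\int[P]_w (tnth (eps w) i ^+ 2)%:E < +oo)%E).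
Variables (a s : R).
Hypothesis a0 : a != 0.
Let xt w := forward a s (x0 w) (eps w).
Let mxt : measurable_fun [set: Omega] xt.
Proof. exact: measurable_forward. Qed.

(** Since [noise] inverts [denoise], every decision rule is the denoised form of a predictor. The
    two minimizations thus range over corresponding candidates, with errors proportional by the
    positive factor (s / a)^2. *)
Lemma planner_solutions_denoiseP (f : V -> V) : s != 0 ->
  measurable_fun [set: V] f ->
  planner_solutions P x0 xt (fun y => denoise a s y (f y)) <->
  forall i, centered P xt (residual xt eps f i).
Proof.
move=> s0 mf; rewrite planner_solutionsE -(mmseP meps mxt eps2 mf).
have c0 : (0%E < ((s / a) ^+ 2)%:E)%E :> bool.
  by rewrite lte_fin exprn_even_gt0//= mulf_neq0// invr_eq0.
split=> [[_ opt] h mh|opt].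
  have := opt _ (measurable_denoise a s mh).
  by rewrite !mse_denoise// lee_pmul2l.
split=> [|g mg]; first exact: measurable_denoise.
have -> : g = (fun y => denoise a s y (noise a s y (g y))).
  by apply/funext => y; rewrite noiseK.
have mn := measurable_noise a s mg.
by rewrite !mse_denoise// lee_pmul2l//; exact: (opt _ mn).
Qed.

(** Write a rule as the denoised form of a predictor. If it is optimal, its residual and that of f
    are both centered; their difference is a centered function of x_t, hence zero almost surely.
    Conversely, centering survives almost sure modification. *)
Lemma implements_planner_noisy (f : V -> V) : s != 0 ->
  measurable_fun [set: V] f ->
  (forall i, centered P xt (residual xt eps f i)) ->
  implements_planner P a s x0 xt f.
Proof.
move=> s0 mf cf xh mxh.
have mn := measurable_noise a s mxh.
rewrite [X in planner_solutions _ _ _ X](_ : _ =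
    fun y => denoise a s y (noise a s y (xh y))); last first.
  by apply/funext => y; rewrite noiseK.
rewrite planner_solutions_denoiseP//; split=> [cn|fE].
  have ae_i i : {ae P, forall w,
      tnth (noise a s (xt w) (xh (xt w))) i = tnth (f (xt w)) i}.
    have : {ae P, forall w,
        tnth (noise a s (xt w) (xh (xt w))) i - tnth (f (xt w)) i = 0}.
      apply: (@centered_comp_eq0 _ _ _ _ _ P xt mxt
        (fun y => tnth (noise a s y (xh y)) i - tnth (f y) i)).
        apply: measurable_funB; first exact: ((measurable_fun_tnthP _).1 mn).
        exact: ((measurable_fun_tnthP _).1 mf).
      have := centeredB mxt (cf i) (cn i); congr centered; apply/funext => w.
      by rewrite /residual; ring.
    by apply: filterS => w /eqP; rewrite subr_eq0 => /eqP.
  have ae_all : {ae P, forall w, forall i,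
      tnth (noise a s (xt w) (xh (xt w))) i = tnth (f (xt w)) i}.
    exact: filter_forall.
  apply: filterS ae_all => w nE.
  rewrite -(noiseK (xt w) (xh (xt w)) a0 s0); congr denoise.
  exact: eq_from_tnth.
move=> i; apply: centered_ae_eq (cf i) => //.
  apply: measurable_funB; first exact: ((measurable_fun_tnthP _).1 meps).
  exact: ((measurable_fun_tnthP _).1 (measurableT_comp mn mxt)).
by apply: filterS fE => w fE; rewrite /residual fE denoiseK.
Qed.

(** Here x_t = a x_0, so denoising returns x_0 whatever the predictor. The optimal error is
    therefore 0, reached exactly by the rules that recover x_0 almost surely. *)
Lemma implements_planner_noiseless (f : V -> V) : s = 0 ->
  implements_planner P a s x0 xt f.
Proof.
move=> s0 xh mxh.
have dE w v : denoise a s (xt w) v = x0 w.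
  by apply: eq_from_tnth => i; rewrite !tnth_mktuple s0; field.
have mxhX := measurableT_comp mxh mxt.
have mD : measurable_fun [set: Omega] (fun w => (sqdist (x0 w) (xh (xt w)))%:E).
  by apply/measurable_EFinP; exact: measurable_sqdist.
have mse0 g : {ae P, forall w, g (xt w) = x0 w} -> measurable_fun [set: V] g ->
    mse P x0 xt g = 0%E.
  move=> gE mg; rewrite /mse unlock -(integral0 P setT).
  apply: ge0_ae_eq_integral => //.
  - apply/measurable_EFinP; apply: measurable_sqdist => //.
    exact: (measurableT_comp mg mxt).
  - by move=> w _; rewrite lee_fin sqdist_ge0.
  - apply: filterS gE => w -> _; rewrite /sqdist big1// => i _.
    by rewrite subrr expr0n.
rewrite planner_solutionsE; split=> [[_ opt]|xhE].
  (* Any measurable predictor gives a competitor of error 0; the identity is used. *)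
  have := opt _ (measurable_denoise a s (@measurable_id _ V setT)).
  have d0 := measurable_denoise a s (@measurable_id _ V setT).
  rewrite [leRHS](mse0 _ _ d0); last by apply: aeW => w; rewrite dE.
  rewrite /mse unlock => le0.
  have D0 : ae_eq P setT (fun w => (sqdist (x0 w) (xh (xt w)))%:E) (cst 0%E).
    apply/(ae_eq_integral_abs P measurableT mD).1.
    under eq_integral do rewrite gee0_abs ?lee_fin ?sqdist_ge0//.
    apply/eqP; rewrite eq_le le0 integral_ge0// => w _.
    by rewrite lee_fin sqdist_ge0.
  apply: filterS D0 => w /(_ Logic.I) -[]; rewrite dE => /eqP.
  rewrite psumr_eq0 => [/allP D0|i _]; last exact: sqr_ge0.
  apply: eq_from_tnth => i; apply/esym/eqP; rewrite -subr_eq0 -sqrf_eq0.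
  by apply: D0; rewrite mem_index_enum.
split=> // g mg; rewrite mse0//.
  by rewrite /mse unlock integral_ge0// => w _; rewrite lee_fin sqdist_ge0.
by apply: filterS xhE => w ->; rewrite dE.
Qed.

Lemma implements_planner_centered (f : V -> V) :
  measurable_fun [set: V] f ->
  (forall i, centered P xt (residual xt eps f i)) ->
  implements_planner P a s x0 xt f.
Proof.
move=> mf cf; have [s0|s0] := eqVneq s 0.
  exact: implements_planner_noiseless.
exact: implements_planner_noisy.
Qed.


End implements.

(** * Random time *)

Section random_time.
Context (R : realType) (dO : measure_display) (Omega : measurableType dO)
  (P : probability Omega R) (d : nat).
Local Notation V := (d.-tuple R).
Local Notation I01 := (`[0, 1]%classic : set R).
Variables (x0 eps : {RV P >-> V}) (tau : {RV P >-> R}) (alpha sigma : R -> R).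
Hypotheses (malpha : measurable_fun I01 alpha) (msigma : measurable_fun I01 sigma)
  (eps2 : forall i, (\int[P]_w (tnth (eps w) i ^+ 2)%:E < +oo)%E)
  (tau01 : forall w, tau w \in `[0, 1])
  (tau_indep : independent_RVs P tau (fun w => (x0 w, eps w))).
Let x t w := forward (alpha t) (sigma t) (x0 w) (eps w).

Let mZ : measurable_fun [set: Omega] (fun w => (x0 w, eps w)).
Proof. exact: measurable_fun_pair. Qed.
Let Z : {RV P >-> (V * V)%type} := RV_of P mZ.

(* alpha, sigma and the predictors are only measurable over times in [0, 1];
   cutting them off outside makes everything measurable on the whole space. *)
Let observe (z : R * (V * V)) : V :=
  forward ((alpha \_ I01) z.1) ((sigma \_ I01) z.1) z.2.1 z.2.2.

Let mobserve : measurable_fun [set: R * (V * V)] observe.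
Proof.
have ma := (measurable_restrictT alpha (measurable_itv `[0, 1])).1 malpha.
have ms := (measurable_restrictT sigma (measurable_itv `[0, 1])).1 msigma.
apply: measurable_tuple_linear.
- exact: (measurableT_comp ma).
- exact: (measurableT_comp ms).
- exact: (measurableT_comp measurable_fst measurable_snd).
- exact: (measurableT_comp measurable_snd measurable_snd).
Qed.

Let observeE t w : t \in `[0, 1] -> observe (t, Z w) = x t w.
Proof. by move=> t01; rewrite /observe /= !patchE mem_set. Qed.

Let extend (e : V -> R -> V) (z : V * R) : V :=
  if z.2 \in `[0, 1] then e z.1 z.2 else [tuple 0 | i < d].

Let extendE (e : V -> R -> V) y t : t \in `[0, 1] -> extend e (y, t) = e y t.
Proof. by rewrite /extend /= => ->. Qed.

Let mextend (e : V -> R -> V) : noise_predictors e ->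
  measurable_fun [set: V * R] (extend e).
Proof.
move=> me.
have m01 : measurable_fun [set: V * R] (fun z => z.2 \in `[0, 1]).
  apply: (measurable_fun_bool true); rewrite setTI.
  rewrite (_ : _ @^-1` _ = snd @^-1` I01); last first.
    by apply/seteqP; split => z.
  rewrite -[X in measurable X]setTI.
  exact: (@measurable_snd _ _ V R measurableT I01 (measurable_itv _)).
exact: measurable_fun_if.
Qed.

(** As [tau] stays in [0, 1], the cutoffs are invisible, and the loss becomes a mean squared error
    with observation (x_tau, tau). *)
Let lossE (e : V -> R -> V) :
  diffusion_loss P alpha sigma x0 eps tau e =
  ('E_P[fun w => sqdist (eps w) (extend e (observe (tau w, Z w), tau w))])%E.
Proof.
rewrite /diffusion_loss; congr expectation; apply/funext => w.
by rewrite extendE// observeE.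
Qed.

Let mjoint : measurable_fun [set: Omega] (fun w => (observe (tau w, Z w), tau w)).
Proof.
apply: measurable_fun_pair => //; apply: (measurableT_comp mobserve).
exact: measurable_fun_pair.
Qed.

Lemma ae_unit_interval : {ae distribution P tau, forall t, t \in `[0, 1]}.
Proof.
exists (~` I01); split; first by apply: measurableC; exact: measurable_itv.
  rewrite /distribution /pushforward (_ : _ @^-1` _ = set0) ?measure0//.
  by rewrite -subset0 => w /= /(_ (tau01 w)).
by move=> t /= nt; exact: nt.
Qed.

Let integrable_eps : integrable_vector P eps.
Proof.
move=> i; apply: integrable_sqr_integrable => //.
exact: ((measurable_fun_tnthP _).1 (measurable_funPT eps)).
Qed.

Let mx t : measurable_fun [set: Omega] (x t).
Proof. exact: measurable_forward. Qed.

Lemma measurable_noise_predictor_slice (e : V -> R -> V) t :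
  noise_predictors e -> t \in `[0, 1] ->
  measurable_fun [set: V] (e^~ t).
Proof.
move=> me t01.
have := measurable_fun_pair1 t (mextend me).
by congr measurable_fun; apply/funext => y; exact: extendE.
Qed.

Lemma loss_minimizer_cond_expectation (e : V -> R -> V) :
  loss_minimizers P alpha sigma x0 eps tau e ->
  {ae distribution P tau, forall t,
    is_cond_expectation P eps (x t) (e^~ t)}.
Proof.
move=> [me opt]; have mE := mextend me.
pose X w := (observe (tau w, Z w), tau w).
have c i : centered P X (residual X eps (extend e) i).
  apply: ((mmseP (measurable_funPT eps) mjoint eps2 mE).1 _ i) => h mh.
  (* Optimality is known among predictors only; a competitor h of the joint observation becomes one
     by currying. *)
  have mh' : noise_predictors (fun y t => h (y, t)).
    apply: measurable_funTS; congr measurable_fun : mh.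
    by apply/funext => -[].
  have := opt _ mh'; rewrite !lossE; congr (_ <= _)%E.
  by congr expectation; apply/funext => w; rewrite extendE.
have ci i : {ae distribution P tau, forall t,
    centered P (fun w => observe (t, Z w))
      (fun w => tnth (eps w) i - tnth (extend e (observe (t, Z w), t)) i)}.
  apply: (@centered_slices _ _ _ _ _ _ _ P d tau Z tau_indep observe
    (fun z => tnth z.2.2 i - tnth (extend e (observe z, z.1)) i)) => //.
  apply: measurable_funB.
    exact: (measurableT_comp (measurable_tnth i)
      (measurableT_comp measurable_snd measurable_snd)).
    apply: (measurableT_comp (measurable_tnth i)); apply: (measurableT_comp mE).
    exact: measurable_fun_pair.
  exact: (c i).
have call : {ae distribution P tau, forall t, forall i,
    centered P (fun w => observe (t, Z w))
      (fun w => tnth (eps w) i - tnth (extend e (observe (t, Z w), t)) i)}.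
  exact: filter_forall.
apply: filterS2 ae_unit_interval call => t t01 ct.
apply/is_cond_expectationP => //; split; first exact: measurable_noise_predictor_slice.
move=> i; have := ct i; congr centered; apply/funext => w.
  by rewrite observeE.
by rewrite extendE// observeE.
Qed.

(** Tonelli writes the loss as the integral over t of the fixed-time losses, and at almost every t
    the conditional expectation does at least as well as any competitor. *)
Lemma cond_expectation_loss_minimizer (e : V -> R -> V) : noise_predictors e ->
  {ae distribution P tau, forall t,
    is_cond_expectation P eps (x t) (e^~ t)} ->
  loss_minimizers P alpha sigma x0 eps tau e.
Proof.
move=> me ce; split=> // h mh; rewrite !lossE unlock.
pose F g (z : R * (V * V)) := (sqdist z.2.2 (extend g (observe z, z.1)))%:E.
have mF g : noise_predictors g -> measurable_fun [set: R * (V * V)] (F g).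
  move=> mg; apply/measurable_EFinP; apply: measurable_sqdist.
    exact: (measurableT_comp measurable_snd measurable_snd).
  apply: (measurableT_comp (mextend mg)).
  exact: measurable_fun_pair.
have F0 g z : (0 <= F g z)%E by rewrite lee_fin sqdist_ge0.
have LE g : noise_predictors g ->
    (\int[P]_w F g (tau w, Z w) = \int[distribution P tau]_t \int[P]_w F g (t, Z w))%E.
  by move=> mg; apply: ge0_fubini_independent => //; exact: mF.
(* Comparing the outer integrals requires the fixed-time losses to be measurable in t. *)
have mI g : noise_predictors g ->
    measurable_fun [set: R] (fun t => \int[P]_w F g (t, Z w))%E.
  move=> mg.
  have : measurable_fun [set: R] (fubini_F (distribution P Z) (F g)).
    by apply: measurable_fun_fubini_tonelli_F => //; exact: mF.
  congr measurable_fun; apply/funext => t; rewrite /fubini_F.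
  rewrite ge0_integral_distribution//.
  exact: measurable_fun_pair2 (mF _ mg).
have := LE _ me; rewrite /F /= => ->.
have := LE _ mh; rewrite /F /= => ->.
apply: ae_ge0_le_integral => //.
- by move=> t _; apply: integral_ge0 => w _; exact: (F0 e (t, Z w)).
- exact: (mI e).
- by move=> t _; apply: integral_ge0 => w _; exact: (F0 h (t, Z w)).
- exact: (mI h).
apply: filterS2 ae_unit_interval ce => t t01 ce _.
have [_ c] := (is_cond_expectationP (mx t) integrable_eps _).1 ce.
have met := measurable_noise_predictor_slice me t01.
have mht := measurable_noise_predictor_slice mh t01.
have := (mmseP (measurable_funPT eps) (mx t) eps2 met).2 c _ mht.
rewrite unlock; congr (_ <= _)%E; apply: eq_integral => w _;
  by rewrite extendE// observeE.
Qed.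

End random_time.

(** * Equivalence of training and planning *)

Theorem corollary1 (R : realType) (dO : measure_display)
  (Omega : measurableType dO) (P : probability Omega R) (d : nat)
  (x0 eps : {RV P >-> d.-tuple R}) (tau : {RV P >-> R}) (alpha sigma : R -> R)
  (schedule : vp_schedule alpha sigma)
  (alpha_neq0 : forall t, t \in `[0, 1] -> alpha t != 0)
  (x0_integrable : integrable_vector P x0)
  (eps_gaussian : std_gaussian P eps)
  (x0_eps_independent : independent_RVs P x0 eps)
  (tau_range : forall w, tau w \in `[0, 1])
  (tau_independent : independent_RVs P tau (fun w => (x0 w, eps w))) :
  let x t w := forward (alpha t) (sigma t) (x0 w) (eps w) in
  [/\ (* maximizing welfare is minimizing the mean squared error *)
      forall t, t \in `[0, 1] ->
        planner_solutions P x0 (x t) =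
        argmin (@decision_rules R d) (mse P x0 (x t)),
      (* the minimizer eps_star(x_t, t) = E[eps | x_t] of the loss implements
         the planner's rule at every time *)
      forall eps_star : d.-tuple R -> R -> d.-tuple R,
        noise_predictors eps_star ->
        (forall t, t \in `[0, 1] ->
           is_cond_expectation P eps (x t) (eps_star^~ t)) ->
        loss_minimizers P alpha sigma x0 eps tau eps_star /\
        forall t, t \in `[0, 1] ->
          implements_planner P (alpha t) (sigma t) x0 (x t) (eps_star^~ t),
      (* an arbitrary minimizer of the loss is such a conditional expectation,
         and implements the planner's rule, at almost every time *)
      forall e : d.-tuple R -> R -> d.-tuple R,
        loss_minimizers P alpha sigma x0 eps tau e ->
        {ae distribution P tau, forall t,
           is_cond_expectation P eps (x t) (e^~ t) /\
           implements_planner P (alpha t) (sigma t) x0 (x t) (e^~ t)} &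
      (* solving the training problem is solving the planner's problem; when
         sigma_t = 0 the linear relationship does not involve e, and the
         normalization e(x_t, t) = E[eps | x_t] has to be kept *)
      forall e : d.-tuple R -> R -> d.-tuple R,
        noise_predictors e ->
        (loss_minimizers P alpha sigma x0 eps tau e <->
         {ae distribution P tau, forall t,
            planner_solutions P x0 (x t)
              (fun y => denoise (alpha t) (sigma t) y (e y t)) /\
            (sigma t = 0 -> is_cond_expectation P eps (x t) (e^~ t))})].
Proof.
move=> x; have [malpha msigma _ _ _] := schedule.
have meps : measurable_fun [set: Omega] eps by exact: measurable_funPT.
have mx0 : measurable_fun [set: Omega] x0 by exact: measurable_funPT.
have eps2 i := std_gaussian_second_moment_lty i meps eps_gaussian.
have ieps : integrable_vector P eps.
  move=> i; apply: integrable_sqr_integrable => //.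
  exact: ((measurable_fun_tnthP _).1 meps).
have mx t : measurable_fun [set: Omega] (x t) by exact: measurable_forward.
have ae01 := ae_unit_interval tau_range.
have condP t f := is_cond_expectationP (mx t) ieps f.
have implem t f : t \in `[0, 1] -> is_cond_expectation P eps (x t) f ->
    implements_planner P (alpha t) (sigma t) x0 (x t) f.
  by move=> t01 /condP[mf cf]; apply: implements_planner_centered => //;
    exact: alpha_neq0.
(* All claims about the loss reduce to this fixed-time description of its minimizers. *)
have minimizerP e : noise_predictors e ->
    loss_minimizers P alpha sigma x0 eps tau e <->
    {ae distribution P tau, forall t, is_cond_expectation P eps (x t) (e^~ t)}.
  move=> me; split=> [le|].
    exact: (loss_minimizer_cond_expectation malpha msigma eps2 tau_range).
  exact: (cond_expectation_loss_minimizer malpha msigma eps2 tau_range).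
split.
- by move=> t _; exact: planner_solutionsE.
- move=> e me ce; split=> [|t t01]; last exact/implem/ce.
  by apply/minimizerP => //; apply: filterS ae01 => t; exact: ce.
- move=> e le; have [me _] := le.
  apply: filterS2 ae01 ((minimizerP e me).1 le) => t t01 ce.
  by split=> //; exact: implem.
move=> e me; rewrite minimizerP//; split=> H.
  apply: filterS2 ae01 H => t t01 ce; split=> //.
  have [mf _] := (condP _ _).1 ce.
  (* The denoised rule solves the planner's problem because it trivially equals itself almost
     surely. *)
  by apply/(implem _ _ t01 ce); [exact: measurable_denoise|exact: aeW].
apply: filterS2 ae01 H => t t01 [pe ce].
(* At noiseless times the normalization is assumed; at the others, optimality of the denoised rule
   already forces the residual to be centered. *)
have [/ce//|s0] := eqVneq (sigma t) 0.
have mf := measurable_noise_predictor_slice me t01.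
apply/condP; split=> //.
exact: ((planner_solutions_denoiseP mx0 meps eps2 (alpha_neq0 t t01) s0 mf).1 pe).
Qed.
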